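(* Let $d\ge1$. For each $\zeta\in\partial\mathbb B^d$, the function $$h_\zeta(z)=\frac{1+\langle z,\zeta\rangle}{1-\langle z,\zeta\rangle},\qquad z\in\mathbb B^d,$$ is an extreme point of the convex set $S^+_0=\{f\in S^+: f(0)=1\}$.
   Context: $\mathbb B^d$ is the open unit ball of $\mathbb C^d$ and $\langle z,w\rangle=\sum_j z_j\overline{w_j}$. $S^+$ (the positive Schur class) is the set of holomorphic functions $f$ on $\mathbb B^d$ for which the Hermitian kernel $\dfrac{f(z)+\overline{f(w)}}{1-\langle z,w\rangle}$ is positive semidefinite on $\mathbb B^d$. *)

(* Defs.v *)
From HB Require Import structures.
From mathcomp Require Import all_boot all_order all_algebra.
From mathcomp Require Import sesquilinear spectral complex.
From mathcomp Require Import all_classical all_reals all_analysis.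

Set Implicit Arguments.
Unset Strict Implicit.
Unset Printing Implicit Defensive.

Import Order.TTheory GRing.Theory Num.Theory numFieldNormedType.Exports.
Local Open Scope classical_set_scope.
Local Open Scope ring_scope.

(* Equips the concrete type [R[i]] with the normed-space structure that
   [numFieldNormedType] gives to abstract numeric fields. *)
HB.instance Definition _ (R : realType) := NormedModule.copy R[i] R[i]^o.

Section Definitions.
Variable R : realType.

Definition dot (d : nat) (z w : 'rV[R[i]]_d) : R[i] := dotmx z w.

Lemma dotE (d : nat) (z w : 'rV[R[i]]_d) :
  dot z w = \sum_(j < d) z 0 j * Num.conj (w 0 j).
Proof. by rewrite /dot dotmxE mxE; apply: eq_bigr => j _; rewrite !mxE. Qed.

Definition unit_ball (d : nat) : set 'rV[R[i]]_d := [set z | dot z z < 1].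
Arguments unit_ball : clear implicits.

Definition boundary (T : topologicalType) (A : set T) : set T :=
  closure A `\` A°.

(* [differentiable] over the scalar field [R[i]] is Frechet differentiability
   with a [R[i]]-linear differential.  ['valL_0 f] extends [f] by 0 outside of
   [U]; at a point of an open set [U], differentiability does not depend on the
   chosen extension. *)
Definition holomorphic (d : nat) (U : set 'rV[R[i]]_d) (f : U -> R[i]) : Prop :=
  forall z : 'rV[R[i]]_d, U z -> differentiable ('valL_0 f) z.

(* In [R[i]], [0 <= x] means that [x] is real and nonnegative. *)
Definition psd_kernel (T : Type) (K : T -> T -> R[i]) : Prop :=
  forall (n : nat) (x : 'I_n -> T) (c : 'I_n -> R[i]),
    0 <= \sum_(i < n) \sum_(j < n) c i * Num.conj (c j) * K (x i) (x j).

Definition positive_schur (d : nat) : set (unit_ball d -> R[i]) :=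
  [set f | holomorphic f /\
           psd_kernel (fun z w : unit_ball d =>
             (f z + Num.conj (f w)) / (1 - dot (val z) (val w)))].

Lemma unit_ball0 (d : nat) : (0 : 'rV[R[i]]_d) \in unit_ball d.
Proof. by rewrite inE /unit_ball /= /dot dotmxE mul0mx mxE ltr01. Qed.

Definition ball_origin (d : nat) : unit_ball d := SigSub (unit_ball0 d).

Definition positive_schur0 (d : nat) : set (unit_ball d -> R[i]) :=
  [set f | @positive_schur d f /\ f (ball_origin d) = 1].

Definition extreme_point (V : lmodType R[i]) (A : set V) (x : V) : Prop :=
  A x /\
  forall (y z : V) (t : R), A y -> A z -> 0 < t < 1 ->
    x = t%:C%C *: y + (1 - t)%:C%C *: z -> y = x /\ z = x.

Definition cayley_slice (d : nat) (zeta : 'rV[R[i]]_d) : unit_ball d -> R[i] :=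
  fun z => (1 + dot (val z) zeta) / (1 - dot (val z) zeta).

End Definitions.

Arguments unit_ball : clear implicits.
Arguments positive_schur : clear implicits.
Arguments positive_schur0 : clear implicits.

(* Main.v *)
Require Import Defs.
From mathcomp Require Import all_boot all_order all_algebra.
From mathcomp Require Import sesquilinear spectral complex.
From mathcomp Require Import all_classical all_reals all_analysis.
From mathcomp Require Import ring.

Set Implicit Arguments.
Unset Strict Implicit.
Unset Printing Implicit Defensive.

Import Order.TTheory GRing.Theory Num.Theory numFieldNormedType.Exports.
Local Open Scope classical_set_scope.
Local Open Scope ring_scope.

(* Write [k z w = 1 / (1 - <z, w>)], which is positive semidefinite as a sum of
   powers of the Gram kernel.

   Membership: with [a = <z, zeta>], [b = <w, zeta>] and [p] the orthogonal
   projection killing [zeta], the kernel of [h_zeta] is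
   [2 (1 - a)^-1 (1 - b^* )^-1 (1 + <p z, p w> k z w)].

   Extremality: for [f] with [f 0 = 1], the value [gap f] at the vector
   [(1, -2)] of the quadratic form of the kernel of [f] on the points
   [zeta / 2] and [0] is nonnegative, affine in [f], and zero for
   [f = h_zeta].  If [h_zeta] is a proper convex combination of [f] and [g], it
   therefore vanishes for [f] and [g] as well.  A vector isotropic for a positive
   semidefinite kernel lies in its radical; this gives one linear equation on
   [f z] for each [z], the case [z = 0] yielding [f (zeta / 2) = 3] and the
   others then [f z = h_zeta z]. *)

(** * Differentiability and limits *)

(** The differential of [f] serves for [g]. This moves differentiability from a formula on the whole
    space to an extension by 0 from the open ball. *)
Lemma near_eq_differentiable (K : numFieldType) (V W : normedModType K)
    (f g : V -> W) (x : V) :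
  (\forall y \near x, f y = g y) -> differentiable f x -> differentiable g x.
Proof.
move=> fg /diffP [df_cont df].
apply/diffP.
(* ['d g x] is chosen by [get], so it is enough to exhibit one candidate. *)
apply: (@getPex _ (fun dg : {linear V -> W} => continuous dg /\ forall y,
    g y = g (lim (nbhs x)) + dg (y - lim (nbhs x))
          +o_(y \near x) (y - lim (nbhs x)))).
exists ('d f x); split=> //.
have flim : f (lim (nbhs x)) = g (lim (nbhs x)).
  by rewrite lim_id //; exact: (nbhs_singleton fg).
have /eqaddoP gdf : forall e, 0 < e -> \forall y \near x,
    `|(g - (fun y => g (lim (nbhs x)) + 'd f x (y - lim (nbhs x)))) y|
      <= e * `|y - lim (nbhs x)|.
  move=> e e0; have /funext/eqadd_some_oP/(_ e e0) := df.
  apply: filter_app; apply: filterS fg => y fgy.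
  by rewrite !fctE fgy flim.
by move=> y; exact: (congr1 (@^~ y) gdf).
Qed.

Lemma conj_continuous (C : numClosedFieldType) :
  continuous (Num.conj : C -> C).
Proof.
move=> x; apply: (iffRL (@cvgrPdist_lt C C C (nbhs x) _ _ _)) => e e0.
near=> y; rewrite -rmorphB norm_conjC; near: y.
exact: (iffLR (@cvgrPdist_lt C C C (nbhs x) _ id x)).
Unshelve. all: by end_near. Qed.

Lemma cvg_sum_ord (K : numFieldType) (T : Type) (F : set_system T) (n : nat)
    (f : 'I_n -> T -> K) (l : 'I_n -> K) : Filter F ->
  (forall i, f i x @[x --> F] --> l i) ->
  \sum_(i < n) f i x @[x --> F] --> \sum_(i < n) l i.
Proof.
move=> FF; elim: n f l => [|n IHn] f l fl.
  rewrite big_ord0 (_ : (fun=> _) = cst 0); first exact: cvg_cst.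
  by apply/funext => x; rewrite big_ord0.
rewrite big_ord_recl (_ : (fun=> _) =
  (fun x => f ord0 x + \sum_(i < n) f (lift ord0 i) x)).
  by apply: cvgD; [exact: fl | apply: IHn => i; exact: fl].
by apply/funext => x; rewrite big_ord_recl.
Qed.

(** The terms equal their moduli, so [l] equals [|l|] by uniqueness of limits; this also settles
    that [l] is real. *)
Lemma cvgC_ge0 (R : realType) (u : nat -> R[i]) (l : R[i]) :
  (forall n, 0 <= u n) -> u @ \oo --> l -> 0 <= l.
Proof.
move=> u0 ul.
have ul' : u n @[n --> \oo] --> `|l|.
  have -> : u = (fun n => `|u n|) by apply/funext => n; rewrite ger0_norm.
  exact: (@cvg_norm R[i] R[i] _ _ _ u l ul).
by rewrite (cvg_unique (@norm_hausdorff _ _) ul ul').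
Qed.

Lemma cvgC_expr (R : realType) (z : R[i]) :
  `|z| < 1 -> z ^+ n @[n --> \oo] --> 0.
Proof.
have [r rE] : exists r : R, `|z| = r%:C%C.
  by exists (complex.Re `|z|); rewrite RRe_real // ger0_real.
rewrite rE (ltcR r 1) => r1.
have r0 : 0 <= r by rewrite -lecR -rE; exact: normr_ge0.
apply: (iffRL (@cvgr0Pnorm_lt R[i] R[i] _ _ _ (fun n => z ^+ n))) => e e0.
have eE : e = (complex.Re e)%:C%C by rewrite RRe_real // gtr0_real.
have re0 : 0 < complex.Re e by rewrite -ltcR -eE.
have := cvg_expr (_ : `|r| < 1); rewrite ger0_norm // => /(_ r1).
move=> /cvgr0Pnorm_lt/(_ _ re0); apply: filterS => n.
by rewrite ger0_norm ?exprn_ge0 // normrX rE -rmorphXn /= eE ltcR.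
Qed.

(** * Positive semidefinite kernels *)

Section PositiveKernels.
Variables (C : numClosedFieldType) (T : Type).
Implicit Types K L : T -> T -> C.

(* At [C := R[i]] this is convertible to [psd_kernel]; over an abstract field
   [ring] is not disturbed by the several instance paths of [R[i]]. *)
Definition positive_kernel K :=
  forall (n : nat) (x : 'I_n -> T) (c : 'I_n -> C),
    0 <= \sum_(i < n) \sum_(j < n) c i * (c j)^* * K (x i) (x j).

Lemma positive_kernelD K L : positive_kernel K -> positive_kernel L ->
  positive_kernel (fun z w => K z w + L z w).
Proof.
move=> posK posL n x c; have := addr_ge0 (posK n x c) (posL n x c).
rewrite -big_split; congr (0 <= _); apply: eq_bigr => i _.
by rewrite -big_split; apply: eq_bigr => j _; rewrite mulrDr.
Qed.

Lemma positive_kernel_sum n (K : 'I_n -> T -> T -> C) :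
  (forall k, positive_kernel (K k)) ->
  positive_kernel (fun z w => \sum_(k < n) K k z w).
Proof.
elim: n K => [|n IHn] K posK.
  move=> m x c; rewrite big1 // => i _; rewrite big1 // => j _.
  by rewrite big_ord0 mulr0.
move=> m x c.
have := positive_kernelD (posK ord0) (IHn _ (fun k => posK (lift ord0 k))) x c.
congr (0 <= _); apply: eq_bigr => i _; apply: eq_bigr => j _.
by rewrite big_ord_recl.
Qed.

(** The factor [g] is absorbed into the coefficients. *)
Lemma positive_kernel_congr (g : T -> C) K : positive_kernel K ->
  positive_kernel (fun z w => g z * (g w)^* * K z w).
Proof.
move=> posK n x c; have := posK n x (fun i => c i * g (x i)).
congr (0 <= _); apply: eq_bigr => i _; apply: eq_bigr => j _.
by rewrite rmorphM /=; ring.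
Qed.

Lemma positive_kernel1 : positive_kernel (fun _ _ => 1).
Proof.
move=> n x c.
rewrite (_ : \sum_(i < n) _ = (\sum_(i < n) c i) * (\sum_(i < n) c i)^*).
  exact: mul_conjC_ge0.
rewrite rmorph_sum mulr_suml; apply: eq_bigr => i _; rewrite mulr_sumr.
by apply: eq_bigr => j _; rewrite mulr1.
Qed.

(** The case of the Schur product theorem with a Gram kernel as one factor: the product is a sum of
    congruences of [K] by the [g k]. *)
Lemma positive_kernelM_gram d (g : 'I_d -> T -> C) K : positive_kernel K ->
  positive_kernel (fun z w => (\sum_(k < d) g k z * (g k w)^*) * K z w).
Proof.
move=> posK n x c.
have := positive_kernel_sum (fun k => positive_kernel_congr (g k) posK) x c.
congr (0 <= _); apply: eq_bigr => i _; apply: eq_bigr => j _.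
by rewrite mulr_suml.
Qed.

Lemma positive_kernel_form2 K (x y : T) (a b : C) : positive_kernel K ->
  0 <= a * a^* * K x x + a * b^* * K x y + b * a^* * K y x + b * b^* * K y y.
Proof.
move/(_ 2 (fun i => nth x [:: x; y] i) (fun i => nth 0 [:: a; b] i)).
by rewrite !big_ord_recl !big_ord0 /= !addr0 !addrA.
Qed.

Lemma positive_kernel_null K (x y z : T) (a b : C) :
  positive_kernel K -> (forall u v, K u v = (K v u)^*) ->
  a * a^* * K x x + a * b^* * K x y + b * a^* * K y x + b * b^* * K y y = 0 ->
  a * K x z + b * K y z = 0.
Proof.
move=> posK Kherm Q0; set l := _ + _.
have Kzz : 0 <= K z z.
  by have := posK 1 (fun=> z) (fun=> 1); rewrite !big_ord1 conjC1 !mul1r.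
have lc : K z x * a^* + K z y * b^* = l^*.
  by rewrite rmorphD !rmorphM /= -!Kherm; ring.
(* A third point [z] of weight [s] is added; by [Q0] only the terms involving [s] survive. *)
have Q s : 0 <= s^* * l + s * l^* + s * s^* * K z z.
  have := posK 3 (fun i => nth x [:: x; y; z] i)
                 (fun i => nth 0 [:: a; b; s] i).
  rewrite !big_ord_recl !big_ord0 /= !addr0 => /le_trans; apply.
  rewrite le_eqVlt; apply/orP; left; apply/eqP.
  by rewrite -lc /l -[RHS]add0r -Q0; ring.
(* At [s = - e * l] the form [Q] equals [- e |l|^2 (1 + e)]. *)
apply/eqP/negPn/negP => l0.
(* With this [e] the quadratic term is [(1 - e)] times [e |l|^2], too small to offset the cross
   terms [- 2 e |l|^2]. *)
pose e := (1 + K z z)^-1.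
have e0 : 0 < e by rewrite invr_gt0 ltr_wpDr.
have ec : e^* = e by apply/CrealP/ger0_real/ltW.
have eK : e * K z z = 1 - e.
  apply/eqP; rewrite eq_sym subr_eq -[X in _ + X]mulr1 -mulrDr addrC.
  by rewrite mulVf // gt_eqF // ltr_wpDr.
have ll : 0 < l * l^* by rewrite mul_conjC_gt0.
have := Q (- e * l); rewrite rmorphM rmorphN /= ec.
have -> : - e * l^* * l + - e * l * l^* + - e * l * (- e * l^*) * K z z
  = - (e * (l * l^*) * (1 + e)) + e * (l * l^*) * (e * K z z - (1 - e)) by ring.
by rewrite eK subrr mulr0 addr0 oppr_ge0 lt_geF // mulr_gt0 ?addr_gt0 // mulr_gt0.
Qed.

End PositiveKernels.

(** * The unit ball *)

Section UnitBall.
Variables (R : realType) (d : nat).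
Local Notation vec := 'rV[R[i]]_d.

Lemma dotC (z w : vec) : dot w z = (dot z w)^*.
Proof.
rewrite !dotE rmorph_sum; apply: eq_bigr => j _.
by rewrite rmorphM /= conjCK mulrC.
Qed.

Lemma dot_ge0 (z : vec) : 0 <= dot z z.
Proof. by rewrite dotE sumr_ge0 // => j _; rewrite mul_conjC_ge0. Qed.

Lemma dotDl (z1 z2 w : vec) : dot (z1 + z2) w = dot z1 w + dot z2 w.
Proof.
by rewrite !dotE -big_split; apply: eq_bigr => j _; rewrite mxE mulrDl.
Qed.

Lemma dotZl a (z w : vec) : dot (a *: z) w = a * dot z w.
Proof.
by rewrite !dotE mulr_sumr; apply: eq_bigr => j _; rewrite mxE mulrA.
Qed.

Lemma dot0l (w : vec) : dot 0 w = 0.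
Proof. by rewrite dotE big1 // => j _; rewrite mxE mul0r. Qed.

Lemma dotBl (z1 z2 w : vec) : dot (z1 - z2) w = dot z1 w - dot z2 w.
Proof. by rewrite dotDl -scaleN1r dotZl mulN1r. Qed.

Lemma dotZr a (z w : vec) : dot z (a *: w) = a^* * dot z w.
Proof. by rewrite dotC dotZl rmorphM /= -dotC. Qed.

Lemma dotBr (z w1 w2 : vec) : dot z (w1 - w2) = dot z w1 - dot z w2.
Proof. by rewrite dotC dotBl rmorphB /= -!dotC. Qed.

(** Cauchy-Schwarz. Allowing [w] on the sphere covers both [zeta] and points of the ball. *)
Lemma norm_dot_lt1 (z w : vec) : dot z z < 1 -> dot w w <= 1 -> `|dot z w| < 1.
Proof.
move=> z1 w1; rewrite -(@expr_lt1 _ 2) //.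
have [+ _] := CauchySchwarz (@dotmx R[i] d) z w.
move=> /le_lt_trans; apply; apply: le_lt_trans z1.
by rewrite ler_piMr // dot_ge0.
Qed.

Lemma one_sub_dot_neq0 (z w : vec) :
  dot z z < 1 -> dot w w <= 1 -> 1 - dot z w != 0.
Proof.
move=> z1 w1; apply/negP; rewrite subr_eq0 => /eqP zw.
by have := norm_dot_lt1 z1 w1; rewrite -zw normr1 ltxx.
Qed.

Lemma dotl_differentiable (z w : vec) :
  differentiable (fun u : vec => dot u w : R[i]) z.
Proof.
rewrite (_ : (fun u => _) =
  \sum_(j < d) ((w 0 j)^* \*: (fun u : vec => u 0 j : R[i]^o))).
  apply: (@differentiable_sum R[i] _ R[i]^o) => j.
  apply: (@differentiableZ R[i] _ R[i]^o); exact: (@differentiable_coord R[i]).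
apply/funext => u; rewrite dotE fct_sumE; apply: eq_bigr => j _.
by rewrite mulrC.
Qed.

Lemma dot_self_continuous : continuous (fun z : vec => dot z z : R[i]).
Proof.
move=> z; rewrite /continuous_at dotE.
rewrite (_ : (fun w => _) =
  fun w : vec => \sum_(j < d) w 0 j * Num.conj (w 0 j)).
  apply: (@cvg_sum_ord R[i] _ (nbhs z) _ _ _ (nbhs_filter z)) => j.
  apply: (@cvgM R[i] _ (nbhs z) (nbhs_filter z)).
    exact: (@coord_continuous R[i]).
  apply: (@continuous_comp _ _ _ (fun w : vec => w 0 j)
    (Num.conj : R[i] -> R[i])); last exact: (@conj_continuous R[i]).
  exact: (@coord_continuous R[i]).
by apply/funext => w; rewrite dotE.
Qed.

Lemma unit_ball_open : open (unit_ball R d).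
Proof.
rewrite openE => z z1; rewrite /interior.
have := @cvgr_norm_lt R[i] R[i] _ (nbhs z) (nbhs_filter z) _ _
  (@dot_self_continuous z) 1.
rewrite (ger0_norm (dot_ge0 z)) => /(_ z1); apply: filterS => w.
by rewrite (ger0_norm (dot_ge0 w)).
Qed.

Lemma boundary_unit_ball (z : vec) : boundary (unit_ball R d) z -> dot z z = 1.
Proof.
move=> [z_closure zNinterior].
have z1 : ~ dot z z < 1.
  by move=> zlt1; apply: zNinterior; exact: unit_ball_open.
have [//|zgt1|//] := real_ltgtP (ger0_real (dot_ge0 z)) (@real1 R[i]).
(* Outside the closed ball, a neighbourhood of [z] misses the ball, against [z] being in the
   closure. *)
have /z_closure [w [w1]] : nbhs z [set w | 1 < dot w w].
  have := @cvgr_norm_gt R[i] R[i] _ (nbhs z) (nbhs_filter z) _ _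
    (@dot_self_continuous z) 1.
  rewrite (ger0_norm (dot_ge0 z)) => /(_ zgt1); apply: filterS => w /=.
  by rewrite (ger0_norm (dot_ge0 w)).
by move=> /(lt_trans w1); rewrite ltxx.
Qed.

Lemma dot_val_lt1 (z : unit_ball R d) : dot (val z) (val z) < 1.
Proof. exact: set_valP z. Qed.

Lemma positive_drury_arveson :
  positive_kernel (fun z w : unit_ball R d => (1 - dot (val z) (val w))^-1).
Proof.
have posX N :
    positive_kernel (fun z w : unit_ball R d => dot (val z) (val w) ^+ N).
  elim: N => [|N IHN]; first exact: positive_kernel1.
  move=> n x c.
  have := positive_kernelM_gram (fun k (z : unit_ball R d) => val z 0 k) IHN x c.
  congr (0 <= _); apply: eq_bigr => i _; apply: eq_bigr => j _.
  by rewrite exprS dotE.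
move=> n x c.
(* The form of the [N]-th partial sum of the geometric series for the kernel; nonnegativity passes
   to the limit. *)
pose u N : R[i] := \sum_(i < n) \sum_(j < n)
  c i * (c j)^* * \sum_(k < N) dot (val (x i)) (val (x j)) ^+ k.
apply: (@cvgC_ge0 R u) => [N|].
  exact: (positive_kernel_sum (fun k : 'I_N => posX k)).
apply: (@cvg_sum_ord R[i]) => i; apply: (@cvg_sum_ord R[i]) => j.
apply: (@cvgM R[i]); first exact: cvg_cst.
set a := dot _ _.
have a1 : `|a| < 1 := norm_dot_lt1 (dot_val_lt1 _) (ltW (dot_val_lt1 _)).
have a0 : 1 - a != 0 :=
  one_sub_dot_neq0 (dot_val_lt1 _) (ltW (dot_val_lt1 _)).
rewrite (_ : (fun N => _) = (fun N => (1 - a ^+ N) * (1 - a)^-1)); last first.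
  apply/funext => N; rewrite -[X in X * _]opprB subrX1 -mulNr opprB.
  by rewrite mulrAC divff // mul1r.
rewrite -[X in _ --> X]mul1r; apply: (@cvgM R[i]); last exact: cvg_cst.
rewrite -[X in _ --> X]subr0; apply: (@cvgB R[i] R[i]); first exact: cvg_cst.
exact: cvgC_expr.
Qed.

End UnitBall.

(** * The Cayley slice *)

(* Stated for an abstract field for the sake of [field]; [b] and [F'] stand for
   conjugates. *)
Lemma cayley_kernel_identity (K : fieldType) (a b D : K) :
  1 - a != 0 -> 1 - b != 0 -> 1 - D != 0 ->
  ((1 + a) / (1 - a) + (1 + b) / (1 - b)) / (1 - D) =
  2 * ((1 - a)^-1 * (1 - b)^-1 * (1 + (D - b * a) * (1 - D)^-1)).
Proof. by move=> a1 b1 D1; field; apply/and3P. Qed.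

Lemma gap_identity (K : numFieldType) (F F' : K) :
  1 * 1 * ((F + F') / (1 - 4^-1)) + 1 * -2 * ((F + 1) / (1 - 0))
  + -2 * 1 * ((1 + F') / (1 - 0)) + -2 * -2 * ((1 + 1) / (1 - 0))
  = 4 - 2 / 3 * (F + F').
Proof. by field. Qed.

Lemma gap_affine_identity (K : numFieldType) (t F F' G G' : K) :
  4 - 2 / 3 * (t * F + (1 - t) * G + (t * F' + (1 - t) * G')) =
  t * (4 - 2 / 3 * (F + F')) + (1 - t) * (4 - 2 / 3 * (G + G')).
Proof. by field. Qed.

Lemma null_eq_origin (K : fieldType) (F : K) :
  1 * ((F + 1) / (1 - 0)) + - 2 * ((1 + 1) / (1 - 0)) = 0 -> F = 3.
Proof.
rewrite subr0 !divr1 => E.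
by apply/eqP; rewrite -subr_eq0 -E; apply/eqP; ring.
Qed.

(** The radical equation at a point [z], with [X] the conjugate of [f z] and [a = <zeta, z>]. *)
Lemma null_eq_cayley (K : numFieldType) (X a : K) :
  1 - a != 0 -> 1 - 2^-1 * a != 0 ->
  1 * ((3 + X) / (1 - 2^-1 * a)) + - 2 * ((1 + X) / (1 - 0)) = 0 ->
  X = (1 + a) / (1 - a).
Proof.
move=> a1 a2; rewrite subr0 divr1 mul1r => /(congr1 ( *%R (1 - 2^-1 * a))).
rewrite mulr0 mulrDr mulrCA divff // mulr1 => E.
apply: (canRL (mulfK a1)); apply/esym/eqP.
by rewrite -subr_eq0 -E; apply/eqP; field.
Qed.

Section CayleySlice.
Variables (R : realType) (d : nat) (zeta : 'rV[R[i]]_d).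
Hypothesis zeta1 : dot zeta zeta = 1.

Let zeta_le1 : dot zeta zeta <= 1. Proof. by rewrite zeta1. Qed.

Lemma cayley_slice_holomorphic : holomorphic (cayley_slice zeta).
Proof.
move=> z z1; apply: (@near_eq_differentiable _ _ _
  (fun w => (1 + dot w zeta) * (1 - dot w zeta)^-1 : R[i])).
  have : nbhs z (unit_ball R d) by exact: unit_ball_open.
  apply: filterS => w w1.
  suff -> : 'valL_0 (cayley_slice zeta) w =
      cayley_slice zeta (SigSub (mem_set w1)) by [].
  by rewrite /= oinv_set_val insubT ?inE.
have dz := dotl_differentiable z zeta.
apply: (@differentiableM R[i] _ (fun w => 1 + dot w zeta)
   (fun w => (1 - dot w zeta)^-1)).
  by apply: (@differentiableD R[i] _ R[i]^o (cst 1)).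
apply: (@differentiableV R[i]).
  exact: (@differentiableB R[i] _ R[i]^o (cst 1)).
exact: one_sub_dot_neq0.
Qed.

Lemma cayley_slice_positive_schur : positive_schur R d (cayley_slice zeta).
Proof.
split; first exact: cayley_slice_holomorphic.
move=> n x c; set k := fun z w : unit_ball R d => (1 - dot (val z) (val w))^-1.
pose p z : 'rV[R[i]]_d := z - dot z zeta *: zeta.
have poskp : positive_kernel
    (fun z w : unit_ball R d => 1 + dot (p (val z)) (p (val w)) * k z w).
  apply: positive_kernelD; first exact: positive_kernel1.
  move=> m y b.
  have := positive_kernelM_gram (fun k (z : unit_ball R d) => p (val z) 0 k)
    (@positive_drury_arveson R d) y b.
  congr (0 <= _); apply: eq_bigr => i _; apply: eq_bigr => j _.
  by rewrite [dot (p _) _]dotE.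
have := positive_kernel_congr
  (fun z : unit_ball R d => (1 - dot (val z) zeta)^-1) poskp.
move=> /(_ n x c) /(mulr_ge0 (ler0n _ 2)).
congr (0 <= _); rewrite mulr_sumr; apply: eq_bigr => i _.
rewrite mulr_sumr; apply: eq_bigr => j _.
(* Since [zeta] is a unit vector, [<p z, p w>] reduces to [<z, w> - <z, zeta> <zeta, w>]. *)
rewrite dotBl !dotBr !dotZl !dotZr zeta1.
rewrite /cayley_slice rmorphM /= !fmorphV /= !rmorphD !rmorphN /= !rmorph1.
rewrite [dot zeta _]dotC mulr1 subrr subr0 cayley_kernel_identity.
- by rewrite mulrCA.
- exact: one_sub_dot_neq0 (dot_val_lt1 _) zeta_le1.
- rewrite -[1]conjC1 -rmorphB conjC_eq0.
  exact: one_sub_dot_neq0 (dot_val_lt1 _) zeta_le1.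
- exact: one_sub_dot_neq0 (dot_val_lt1 _) (ltW (dot_val_lt1 _)).
Qed.

(** * The two-point form at [zeta / 2] and the origin *)

Lemma dot_half_zeta : dot (2^-1 *: zeta) (2^-1 *: zeta) = 4^-1.
Proof. by rewrite dotZl dotZr zeta1 mulr1 fmorphV /= conjC_nat -invfM -natrM. Qed.

Lemma half_zeta_in_ball : 2^-1 *: zeta \in unit_ball R d.
Proof. by rewrite inE /unit_ball /= dot_half_zeta invf_lt1 ?ltr1n. Qed.

Let o : unit_ball R d := ball_origin R d.
Let half_zeta : unit_ball R d := SigSub half_zeta_in_ball.

Let ker (f : unit_ball R d -> R[i]) (z w : unit_ball R d) : R[i] :=
  (f z + (f w)^*) / (1 - dot (val z) (val w)).

Lemma ker_hermitian f (z w : unit_ball R d) : ker f z w = (ker f w z)^*.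
Proof.
rewrite /ker rmorphM /= fmorphV /= !rmorphD /= rmorphN /= conjCK rmorph1 -dotC.
by rewrite [f z + _]addrC.
Qed.

(** Nonnegativity of this quantity is Harnack's bound [Re f (zeta / 2) <= 3], attained by
    [h_zeta]. *)
Definition gap (f : unit_ball R d -> R[i]) : R[i] :=
  4 - 2 / 3 * (f half_zeta + (f half_zeta)^*).

(** The weights come from [h_zeta]: its kernel matrix at [zeta / 2] and 0 has rows (8, 4) and (4,
    2), with null vector [(1, -2)]. *)
Lemma gapE f : f o = 1 ->
  1 * 1^* * ker f half_zeta half_zeta + 1 * (-2)^* * ker f half_zeta o
  + -2 * 1^* * ker f o half_zeta + -2 * (-2)^* * ker f o o = gap f.
Proof.
move=> fo; rewrite /ker fo /= dot_half_zeta !dot0l.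
rewrite [dot _ 0]dotC dot0l rmorphN /= rmorph0 conjC1 conjC_nat.
exact: gap_identity.
Qed.

Lemma gap_ge0 f : positive_schur0 R d f -> 0 <= gap f.
Proof.
by move=> [[_ posf] f0]; rewrite -gapE //; exact: positive_kernel_form2.
Qed.

Lemma gap_eq0 f : positive_schur0 R d f -> gap f = 0 -> f = cayley_slice zeta.
Proof.
move=> [[_ posf] f0] gf0.
have null (z : unit_ball R d) :=
  @positive_kernel_null _ _ (ker f) half_zeta o z 1 (-2) posf
    (ker_hermitian f) (etrans (gapE f0) gf0).
have F3 : f half_zeta = 3.
  apply: null_eq_origin; have := null o.
  by rewrite /ker f0 /= conjC1 dot0l [dot _ 0]dotC dot0l rmorph0.
(* In [null z] the point [z] is the second argument of the kernel, so the equation determines the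
   conjugate of [f z]. *)
apply/funext => z; rewrite -[f z]conjCK.
have -> : (f z)^* = (1 + dot zeta (val z)) / (1 - dot zeta (val z)).
  apply: null_eq_cayley.
  - rewrite dotC -[1]conjC1 -rmorphB conjC_eq0.
    exact: one_sub_dot_neq0 (dot_val_lt1 z) zeta_le1.
  - rewrite -dotZl; apply: one_sub_dot_neq0 (ltW (dot_val_lt1 z)).
    exact: (dot_val_lt1 half_zeta).
  - by have := null z; rewrite /ker F3 f0 /= dot0l dotZl.
by rewrite rmorphM /= fmorphV /= !rmorphD /= rmorphN /= rmorph1 -dotC.
Qed.

Lemma gap_cayley : gap (cayley_slice zeta) = 0.
Proof.
rewrite /gap /cayley_slice /= dotZl zeta1 mulr1.
have -> : (1 + 2^-1) / (1 - 2^-1) = 3 :> R[i] by field.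
by rewrite conjC_nat; field.
Qed.

(** Conjugation fixes the real weights, and their sum being 1 splits the constant 4. *)
Lemma gap_affine f g (t : R) :
  gap (t%:C%C *: f + (1 - t)%:C%C *: g) =
  t%:C%C * gap f + (1 - t)%:C%C * gap g.
Proof.
have conjt : (t%:C%C : R[i])^* = t%:C%C.
  by apply/CrealP/complex_realP; exists t.
rewrite /gap rmorphB /= rmorph1 -gap_affine_identity.
rewrite -[(_ + _) half_zeta]/(t%:C%C * f half_zeta
                              + (1 - t%:C%C) * g half_zeta).
by rewrite [in LHS]rmorphD !rmorphM /= [in LHS]rmorphB /= rmorph1 conjt.
Qed.

End CayleySlice.

Theorem theorem4p3 (R : realType) (d : nat) (hd : (1 <= d)%N)
    (zeta : 'rV[R[i]]_d) (hzeta : boundary (unit_ball R d) zeta) :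
  extreme_point (positive_schur0 R d) (cayley_slice zeta).
Proof.
have zeta1 := boundary_unit_ball hzeta.
split.
  split; first exact: cayley_slice_positive_schur.
  by rewrite /cayley_slice /= dot0l addr0 subr0 divr1.
move=> f g t Sf Sg /andP[t0 t1] fgE.
have t0C : 0 < t%:C%C by rewrite (ltcR 0).
have t1C : 0 < (1 - t)%:C%C by rewrite (ltcR 0) subr_gt0.
have := gap_affine zeta1 f g t; rewrite -fgE gap_cayley => /esym/eqP.
have gf := mulr_ge0 (ltW t0C) (gap_ge0 zeta1 Sf).
have gg := mulr_ge0 (ltW t1C) (gap_ge0 zeta1 Sg).
(* A zero sum of nonnegative terms with positive weights forces both gaps to vanish. *)
rewrite paddr_eq0 // !mulf_eq0 (gt_eqF t0C) (gt_eqF t1C) /=.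
by move=> /andP[/eqP f0 /eqP g0]; split; exact: gap_eq0.
Qed.
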